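(* Let $G=(V,E)$ be a finite simple graph that is both $P_6$-free and banner-free. If $G$ has an efficient dominating set, then the square $G^2$ is $P_6$-free.
   Context: All graphs are finite, undirected and simple. $P_t$ denotes the path on $t$ vertices. For a family $\mathcal{F}$ of graphs, a graph $G$ is $\mathcal{F}$-free if it contains no induced subgraph isomorphic to a member of $\mathcal{F}$. A banner is the graph obtained from a chordless cycle on four vertices by adding one new vertex adjacent to exactly one vertex of the cycle. An efficient dominating set of $G$ is a subset $D\subseteq V$ that is an independent set such that every vertex of $V\setminus D$ has exactly one neighbor in $D$. For vertices $u,v$, $\mathrm{dist}_G(u,v)$ is the distance between them in $G$. The square of $G=(V,E)$ is the graph $G^2=(V,E^2)$ where $uv\in E^2$ if and only if $\mathrm{dist}_G(u,v)\in\{1,2\}$. *)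

(* Defs.v *)
From mathcomp Require Import all_boot.
Set Implicit Arguments. Unset Strict Implicit. Unset Printing Implicit Defensive.

Definition simple_graph (T : finType) (e : rel T) : Prop :=
  symmetric e /\ irreflexive e.

Definition has_induced (F : finType) (h : rel F) (T : finType) (e : rel T) : Prop :=
  exists f : F -> T, injective f /\ forall i j, e (f i) (f j) = h i j.

Definition H_free (F : finType) (h : rel F) (T : finType) (e : rel T) : Prop :=
  ~ has_induced h e.

Definition path_rel (t : nat) : rel 'I_t :=
  fun i j => (i.+1 == j :> nat) || (j.+1 == i :> nat).

Arguments path_rel t : clear implicits.

Definition banner_edge (a b : nat) : bool :=
  [|| (a == 0) && (b == 1), (a == 1) && (b == 2), (a == 2) && (b == 3),
      (a == 3) && (b == 0) | (a == 0) && (b == 4)].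
Definition banner_rel : rel 'I_5 :=
  fun i j => banner_edge i j || banner_edge j i.

Definition efficient_dominating (T : finType) (e : rel T) (D : {set T}) : Prop :=
  (forall x y, x \in D -> y \in D -> ~~ e x y) /\
  (forall v, v \notin D -> #|[set u in D | e v u]| = 1).

Definition square_rel (T : finType) (e : rel T) : rel T :=
  fun u v => (u != v) && (e u v || [exists w, e u w && e w v]).

(* Main.v *)
Require Import Defs.
From mathcomp Require Import all_boot.
From mathcomp Require Import zify.

(** Let [v 0, ..., v 5] induce a P6 in the square of G. An edge of G between
    consecutive [v i] produces a P6 or a banner, so consecutive vertices have
    midpoints [m i], and [v i] is adjacent in G to [m i] and [m i.-1] only.
    Choose [m i] in D whenever [v i] and [v i.+1] have the same dominator.
    Consecutive midpoints are then adjacent. If [v 0] or [v 1] were not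
    dominated by the dominator of [m 0], the edge from that vertex to its own
    dominator could be prolonged to a P6 through [m 0] and the midpoints near
    [v 3], [v 4], [v 5] unless these three had the same dominator, which is
    impossible since [v 3] and [v 5] are too far apart. Hence [m 0], and by
    symmetry [m 4], lies in D, and then [m 2] and the dominators of [v 2] and
    [v 3] leave no way to avoid a P6. *)

Set Implicit Arguments. Unset Strict Implicit. Unset Printing Implicit Defensive.

Section Graph.

Context (T : finType) (e : rel T).
Hypothesis sym_e : symmetric e.
Hypothesis irr_e : irreflexive e.
Hypothesis P6_free : H_free (path_rel 6) e.
Hypothesis banner_free : H_free banner_rel e.

(** * Forbidden subgraphs given by lists of vertices *)

Lemma no_P6 a b c d x y :
  e a b -> e b c -> e c d -> e d x -> e x y ->
  ~~ e a c -> ~~ e a d -> ~~ e a x -> ~~ e a y -> ~~ e b d -> ~~ e b x ->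
  ~~ e b y -> ~~ e c x -> ~~ e c y -> ~~ e d y -> False.
Proof.
move=> ab bc cd dx xy ac ad ax ay bd bx by_ cx cy dy.
pose s := [:: a; b; c; d; x; y].
have fE : forall i j : 'I_6, e (nth a s i) (nth a s j) = path_rel 6 i j.
  by case=> [[|[|[|[|[|[|i]]]]]] // ?]; case=> [[|[|[|[|[|[|j]]]]]] // ?];
     rewrite /path_rel /= ?irr_e //; first [exact/negbTE | rewrite sym_e; exact/negbTE | rewrite sym_e].
apply: P6_free; exists (fun i : 'I_6 => nth a s i); split=> // i j ij.
(* Distinct vertices of a P6 have distinct neighbourhoods, so the adjacencies alone force
   injectivity. *)
have {}ij k : path_rel 6 i k = path_rel 6 j k by rewrite -!fE ij.
apply/val_inj; move: (ij (inord 0)) (ij (inord 1)) (ij (inord 2)) (ij (inord 3)) (ij (inord 4)).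
rewrite /path_rel !inordK //.
by case: i j {ij} => [[|[|[|[|[|[|i]]]]]] // ?]; case=> [[|[|[|[|[|[|j]]]]]] // ?].
Qed.

(** The cycle is a, b, c, d with x pendant at a. As b and d are twins in the banner, adjacency
    cannot tell them apart, hence the hypothesis [b != d]. *)
Lemma no_banner a b c d x :
  e a b -> e b c -> e c d -> e a d -> ~~ e a c -> ~~ e b d -> b != d ->
  e a x -> ~~ e b x -> ~~ e c x -> ~~ e d x -> False.
Proof.
move=> ab bc cd ad ac bd nbd ax bx cx dx.
pose s := [:: a; b; c; d; x].
have fE : forall i j : 'I_5, e (nth a s i) (nth a s j) = banner_rel i j.
  by case=> [[|[|[|[|[|i]]]]] // ?]; case=> [[|[|[|[|[|j]]]]] // ?];
     rewrite /banner_rel /banner_edge /= ?irr_e //; first [exact/negbTE | rewrite sym_e; exact/negbTE | rewrite sym_e].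
apply: banner_free; exists (fun i : 'I_5 => nth a s i); split=> // i j ij.
have {}eij k : banner_rel i k = banner_rel j k by rewrite -!fE ij.
apply/val_inj; move: ij (eij (inord 0)) (eij (inord 1)) (eij (inord 2)) (eij (inord 3)) (eij (inord 4)).
rewrite /banner_rel /banner_edge !inordK //.
case: i j {eij} => [[|[|[|[|[|i]]]]] // ?]; case=> [[|[|[|[|[|j]]]]] // ?] //= E; by move: nbd; rewrite E eqxx.
Qed.


(** * Far pairs and induced paths of the square *)

Definition far x y := (x != y) && ~~ square_rel e x y.

Lemma square_sym x y : square_rel e x y = square_rel e y x.
Proof.
rewrite /square_rel eq_sym (sym_e x); congr (_ && (_ || _)).
by apply: eq_existsb => w; rewrite andbC (sym_e w y) (sym_e x w).
Qed.

Lemma far_sym x y : far x y -> far y x.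
Proof. by rewrite /far eq_sym square_sym. Qed.

Lemma far_nadj x y : far x y -> ~~ e x y.
Proof. by case/andP=> nxy; rewrite /square_rel nxy /= negb_or => /andP[]. Qed.

Lemma far_adj x y z : far x y -> e x z -> ~~ e y z.
Proof.
case/andP=> nxy; rewrite /square_rel nxy /= negb_or => /andP[_ /existsPn/(_ z)].
by move=> + xz; rewrite xz sym_e.
Qed.

Lemma adj_neq x y z : e x z -> ~~ e y z -> x != y.
Proof. by move=> xz; apply: contraNneq => <-. Qed.

Lemma square_mid x y : square_rel e x y -> ~~ e x y -> exists2 w, e x w & e w y.
Proof.
by case/andP=> _ /orP[->//|/existsP[w /andP[xw wy]]] _; exists w.
Qed.

(** Indexing by [nat] turns subpaths and reversals into index arithmetic; values from [n] on are
    unconstrained. *)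
Definition square_path n (v : nat -> T) :=
  (forall i j, i.+1 < j < n -> far (v i) (v j)) /\
  (forall i, i.+1 < n -> square_rel e (v i) (v i.+1)).

Lemma square_path_sub n k p v :
  square_path n v -> k + p <= n -> square_path p (fun i => v (k + i)).
Proof.
move=> [vF vS] kp; split=> [i j ij|i ip]; first by apply: vF; lia.
by rewrite addnS; apply: vS; lia.
Qed.

Lemma square_path_rev n v :
  square_path n v -> square_path n (fun i => v (n.-1 - i)).
Proof.
move=> [vF vS]; split=> [i j ij|i ip]; first by apply/far_sym/vF; lia.
have -> : n.-1 - i = (n.-1 - i.+1).+1 by lia.
by rewrite square_sym; apply: vS; lia.
Qed.

Ltac adj :=
  first [ done | by rewrite sym_e
        | match goal with F : is_true (far _ _) |- _ =>
            solve [ exact: (far_nadj F) | rewrite sym_e; exact: (far_nadj F)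
                  | apply: (far_adj F); first [done | by rewrite sym_e]
                  | rewrite sym_e; apply: (far_adj F); first [done | by rewrite sym_e]
                  | apply: (far_adj (far_sym F)); first [done | by rewrite sym_e]
                  | rewrite sym_e; apply: (far_adj (far_sym F)); first [done | by rewrite sym_e] ]
          end ].

(** Midpoints a of [v 0], [v 1] and b of [v 2], [v 3] close a 4-cycle with the edge and pendant
    [v 0] if adjacent, and complete a P6 otherwise. *)
Lemma no_inner_edge v : square_path 4 v -> ~~ e (v 1) (v 2).
Proof.
move=> [vF vS]; apply/negP => e12.
have f02 : far (v 0) (v 2) by apply: vF.
have f03 : far (v 0) (v 3) by apply: vF.
have f13 : far (v 1) (v 3) by apply: vF.
have [|a e0a ea1] := @square_mid (v 0) (v 1) (vS 0 isT); first by adj.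
have [|b e2b eb3] := @square_mid (v 2) (v 3) (vS 2 isT); first by adj.
have [ab|ab] := boolP (e a b).
  apply: (@no_banner a (v 1) (v 2) b (v 0)); try adj.
  by rewrite eq_sym; apply: (@adj_neq b (v 1) (v 3)); adj.
by apply: (@no_P6 (v 0) a (v 1) (v 2) b (v 3)); adj.
Qed.

(** * Dominators *)

Variable D : {set T}.
Hypothesis effD : efficient_dominating e D.

(* On a dominating D the default value [x] is never taken. *)
Definition dom x := odflt x [pick u in D | (u == x) || e x u].

Lemma domP x : dom x \in D /\ (dom x == x) || e x (dom x).
Proof.
rewrite /dom; case: pickP => [u /andP[]//|no_u]; case: effD => _ domD.
have [xD|/domD c1] := boolP (x \in D); first by have := no_u x; rewrite xD eqxx.
have : 0 < #|[set u in D | e x u]| by rewrite c1.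
case/card_gt0P=> u; rewrite inE => /andP[uD xu].
by have := no_u u; rewrite uD xu orbT.
Qed.

Lemma dom_uniq x y : y \in D -> (y == x) || e x y -> dom x = y.
Proof.
move=> yD; have [dD] := domP x; case: effD => indD domD.
have [xD|/domD/eqP/cards1P[u Eu]] := boolP (x \in D).
  rewrite !(negbTE (indD _ _ xD _)) ?orbF //.
  by move=> /eqP -> /eqP ->.
have xND : x \notin D.
  apply/negP => xD; have : u \in [set u in D | e x u] by rewrite Eu set11.
  by rewrite inE => /andP[uD]; apply/negP; apply: indD.
have neqx z : z \in D -> z == x = false.
  by move=> zD; apply: contraNF xND => /eqP <-.
rewrite !neqx //= => xd xy.
have : y \in [set u in D | e x u] by rewrite inE yD.
have : dom x \in [set u in D | e x u] by rewrite inE dD.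
by rewrite Eu !inE => /eqP -> /eqP ->.
Qed.

Lemma dom_id x : x \in D -> dom x = x.
Proof. by move=> xD; apply: dom_uniq; rewrite ?eqxx. Qed.

Lemma dom_adj x y : x \in D -> e y x -> dom y = x.
Proof. by move=> xD yx; apply: dom_uniq; rewrite ?yx ?orbT. Qed.

Lemma dom_nadj x y : dom x != dom y -> ~~ e x (dom y).
Proof.
by have [dD _] := domP y; apply: contra => xy; rewrite (dom_adj dD xy).
Qed.

Lemma dom_indep x y : ~~ e (dom x) (dom y).
Proof.
by have [xD _] := domP x; have [yD _] := domP y; case: effD => indD _; apply: indD.
Qed.

(** If x were in D, it would dominate y too; if y were the dominator of x, it would be its own. *)
Lemma dom_diff x y : e x y -> dom x != dom y -> e x (dom x) /\ dom x != y.
Proof.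
move=> xy; have [dD /orP[/eqP dx|->]] := domP x => nd.
  by case/eqP: nd; rewrite dx (@dom_adj x y) // ?[e y x]sym_e // -dx.
by split=> //; apply: contraNneq nd => E; rewrite E dom_id // -E.
Qed.

Lemma dom_far x y : far x y -> dom x != dom y.
Proof.
move=> fxy; apply/eqP => E; have [_] := domP x; have [_] := domP y; rewrite -E.
case/orP=> [/eqP->|yd] /orP[/eqP dx|xd].
- by case/andP: fxy; rewrite dx eqxx.
- by have := far_nadj fxy; rewrite xd.
- by have := far_nadj fxy; rewrite -dx sym_e yd.
- by have := far_adj fxy xd; rewrite yd.
Qed.

(** * Chains of midpoints *)

Definition mid x y :=
  if dom x == dom y then dom x else odflt x [pick w | e x w && e w y].

Lemma midP x y : square_rel e x y -> ~~ e x y -> e x (mid x y) /\ e (mid x y) y.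
Proof.
move=> sxy nxy; rewrite /mid; case: eqP => [E|_]; last first.
  case: pickP => [w /andP[]//|no_w].
  by have [w xw wy] := square_mid sxy nxy; have := no_w w; rewrite xw wy.
have [_ Dx] := domP x; have [_] := domP y; rewrite -E.
have /andP[neq _] := sxy.
case/orP: Dx => [/eqP->|xd]; case/orP => [/eqP dy|yd].
- by rewrite dy eqxx in neq.
- by rewrite sym_e yd in nxy.
- by rewrite -dy xd in nxy.
- by rewrite xd sym_e yd.
Qed.

(* [m i] is a midpoint of [v i] and [v i.+1], so only [m 0], ..., [m n.-2] matter. *)
Definition chain n (v m : nat -> T) :=
  (forall i j, i.+1 < j < n -> far (v i) (v j)) /\
  (forall i, i.+1 < n ->
     [/\ e (v i) (m i), e (v i.+1) (m i), ~~ e (v i) (v i.+1)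
       & dom (v i) = dom (v i.+1) -> m i = dom (v i)]).

Lemma chain_mid n v : square_path n v ->
  (forall i, i.+1 < n -> ~~ e (v i) (v i.+1)) ->
  chain n v (fun i => mid (v i) (v i.+1)).
Proof.
move=> [vF vS] vN; split=> // i ip; have [vm mv] := midP (vS i ip) (vN i ip).
by split; rewrite ?vN // 1?sym_e // /mid => ->; rewrite eqxx.
Qed.

Lemma chain_sub n k p v m : chain n v m -> k + p <= n ->
  chain p (fun i => v (k + i)) (fun i => m (k + i)).
Proof.
move=> [vF vm] kp; split=> [i j ij|i ip]; first by apply: vF; lia.
by rewrite addnS; apply: vm; lia.
Qed.

Lemma chain_rev n v m : chain n v m ->
  chain n (fun i => v (n.-1 - i)) (fun i => m (n.-2 - i)).
Proof.
move=> [vF vm]; split=> [i j ij|i ip]; first by apply/far_sym/vF; lia.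
have [|? ? ? Em] := vm (n.-2 - i); first by lia.
have -> : n.-1 - i = (n.-2 - i).+1 by lia.
have -> : n.-1 - i.+1 = n.-2 - i by lia.
by split=> //; [rewrite sym_e | move=> E; rewrite E; apply: Em].
Qed.

Lemma chain_vv n v m i j : chain n v m -> i < n -> j < n -> ~~ e (v i) (v j).
Proof.
move=> [vF vm]; wlog ij : i j / i <= j => [H ip jp|ip jp].
  by case/orP: (leq_total i j) => ?; [|rewrite sym_e]; apply: H.
have [->|nij] := eqVneq i j; first by rewrite irr_e.
have [ij1|ij1] := boolP (i.+1 < j); first by apply/far_nadj/vF; lia.
by have -> : j = i.+1; [lia | case: (vm i) => //; lia].
Qed.

(** Any further adjacency would make [m k] a common neighbour of a far pair. *)
Lemma chain_vm n v m i k : chain n v m -> i < n -> k.+1 < n ->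
  e (v i) (m k) = (i == k) || (i == k.+1).
Proof.
move=> [vF vm] ip kp; have [vkm vk1m _ _] := vm k kp.
have [->//|nik] := eqVneq i k; have [->//|nik1] := eqVneq i k.+1.
apply/negbTE; case: (ltnP i k) => ik.
  by apply: (@far_adj (v k.+1)) => //; apply/far_sym/vF; lia.
by apply: (@far_adj (v k)) => //; apply/vF; lia.
Qed.

(** * Adjacency of consecutive midpoints *)

Ltac arith :=
  repeat match goal with
  | H : is_true (e _ _) |- _ => clear H
  | H : is_true (~~ e _ _) |- _ => clear H
  | H : is_true (far _ _) |- _ => clear H
  | H : is_true (dom _ != _) |- _ => clear H
  end; lia.

Ltac cadj C :=
  first [ done | by rewrite sym_e
        | by rewrite (chain_vm C) | by rewrite sym_e (chain_vm C)
        | by apply: (chain_vv C) ].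

(** The induced path [v 0], [m 0], [v 1], [m 1] grows to a P6 or a banner for each of the other
    three ways of joining [m 2] to [m 0] and [m 1]. *)
Lemma chain4 v m : chain 4 v m -> ~~ e (m 0) (m 1) ->
  e (m 0) (m 2) /\ ~~ e (m 1) (m 2).
Proof.
move=> C n01; have [m02|n02] := boolP (e (m 0) (m 2)); have [m12|n12] := boolP (e (m 1) (m 2)).
- exfalso; apply: (@no_banner (m 0) (v 1) (m 1) (m 2) (v 0)); try cadj C.
  by rewrite eq_sym; apply: (@adj_neq _ _ (v 3)); cadj C.
- by [].
- by exfalso; apply: (@no_P6 (v 0) (m 0) (v 1) (m 1) (m 2) (v 3)); cadj C.
- by exfalso; apply: (@no_P6 (v 0) (m 0) (v 1) (m 1) (v 2) (m 2)); cadj C.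
Qed.

(** If the edge is missing, [chain4] applies twice, the second time to the shifted chain, and fixes
    all pairs of midpoints but [m 0], [m 3]; either choice there is fatal. *)
Lemma chain5_first v m : chain 5 v m -> e (m 0) (m 1).
Proof.
move=> C; apply: contraT => n01.
have [m02 n12] := chain4 (@chain_sub _ 0 4 _ _ C isT) n01.
have [m13 n23] := chain4 (@chain_sub _ 1 4 _ _ C isT) n12.
rewrite /= in m02 n12 m13 n23.
have [m03|n03] := boolP (e (m 0) (m 3)).
  exfalso; apply: (@no_banner (m 2) (v 3) (m 3) (m 0) (v 2)); try cadj C.
  by rewrite eq_sym; apply: (@adj_neq _ _ (v 0)); cadj C.
by exfalso; apply: (@no_P6 (v 0) (m 0) (m 2) (v 3) (m 3) (m 1)); cadj C.
Qed.

Lemma chain5 v m i : chain 5 v m -> i < 3 -> e (m i) (m i.+1).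
Proof.
move=> C; have m01 := chain5_first C; case: i => [//|[_|[_|//]]].
  (* Read backwards on the first four vertices, [chain4] would deny the edge just obtained. *)
  apply: contraT => n12; rewrite sym_e in n12.
  have [_] := chain4 (chain_rev (@chain_sub _ 0 4 _ _ C isT)) n12.
  by rewrite /= sym_e m01.
by rewrite sym_e; apply: (chain5_first (chain_rev C)).
Qed.

Lemma chain6_consecutive v m i : chain 6 v m -> i < 4 -> e (m i) (m i.+1).
Proof.
move=> C; case: i => [|i] ip; first exact: (chain5_first (@chain_sub _ 0 5 _ _ C isT)).
exact: (chain5 (@chain_sub _ 1 5 _ _ C isT) ip).
Qed.


(** * Dominators along a chain of six *)

(* The path y - x - m - m' - x' - dom x' would be a P6; any chord between the
   ends and the middle creates a 4-cycle with a pendant vertex. *)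
Lemma dom_path x x' m m' y : far x x' -> e x m -> e m m' -> e x' m' ->
  e x y -> y != m -> ~~ e y m -> ~~ e y (dom x') -> dom x' = dom m'.
Proof.
move=> fx xm mm' x'm' xy nym ym yd'; apply/eqP; apply: contraT => nd.
have [x'd' nd'm'] := dom_diff x'm' nd.
have d'm' : ~~ e (dom x') m' by rewrite sym_e; apply: contra nd => /dom_adj -> //; case: (domP x').
have ym' : ~~ e y m'.
  by apply/negP => ym'; apply: (@no_banner m' m x y x'); try adj; rewrite eq_sym.
have d'm : ~~ e (dom x') m.
  by apply/negP => d'm; apply: (@no_banner m m' x' (dom x') x); try adj; rewrite eq_sym.
by exfalso; apply: (@no_P6 y x m m' x' (dom x')); adj.
Qed.

Lemma dom_diff_nadj x y : dom x != dom y -> ~~ e (dom x) y.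
Proof. by move=> nd; rewrite sym_e dom_nadj // eq_sym. Qed.

Lemma detour x x' m n m' w z : far x x' -> dom x != dom m ->
  e x m -> e w m -> e m n -> e n m' -> e x' m' -> e z n ->
  ~~ e m m' -> ~~ e x n -> ~~ e n x' -> ~~ e m z -> ~~ e x z ->
  ~~ e w x -> ~~ e w m' -> ~~ e w x' ->
  ~~ e (dom x) w -> ~~ e (dom x) z -> False.
Proof.
move=> fx nd xm wm mn nm' x'm' zn nmm' xn nx' mz xz wx wm' wx' dw dz.
have [xd ndm] := dom_diff xm nd; have dm := dom_diff_nadj nd.
have dn : ~~ e (dom x) n.
  by apply/negP => dn; apply: (@no_banner n m x (dom x) z); try adj; rewrite eq_sym.
have [dm'|dm'] := boolP (e (dom x) m').
  by apply: (@no_P6 x' m' (dom x) x m w); adj.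
by apply: (@no_P6 (dom x) x m n m' x'); adj.
Qed.

Lemma chain6_reach v m j : chain 6 v m -> 2 < j < 5 -> ~~ e (m 0) (m j) ->
  exists l, [/\ 0 < l < j, e (m 0) (m l) & e (m l) (m j)].
Proof.
move=> C jb n0j.
have m01 := @chain6_consecutive _ _ 0 C isT; have m12 := @chain6_consecutive _ _ 1 C isT.
have m23 := @chain6_consecutive _ _ 2 C isT; have m34 := @chain6_consecutive _ _ 3 C isT.
have {jb} : j = 3 \/ j = 4 by lia.
case=> Ej; rewrite {j}Ej in n0j *.
  have [m02|n02] := boolP (e (m 0) (m 2)); first by exists 2.
  have [m13|n13] := boolP (e (m 1) (m 3)); first by exists 1.
  by exfalso; apply: (@no_P6 (v 0) (m 0) (m 1) (m 2) (m 3) (v 4)); cadj C.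
have [m14|n14] := boolP (e (m 1) (m 4)); first by exists 1.
have [m03|n03] := boolP (e (m 0) (m 3)); first by exists 3.
have [m02|n02] := boolP (e (m 0) (m 2)); have [m24|n24] := boolP (e (m 2) (m 4)).
- by exists 2.
- by exfalso; apply: (@no_P6 (v 0) (m 0) (m 2) (m 3) (m 4) (v 5)); cadj C.
- by exfalso; apply: (@no_P6 (v 0) (m 0) (m 1) (m 2) (m 4) (v 5)); cadj C.
have [m13|n13] := boolP (e (m 1) (m 3)).
  by exfalso; apply: (@no_P6 (v 0) (m 0) (m 1) (m 3) (m 4) (v 5)); cadj C.
by exfalso; apply: (@no_P6 (v 0) (m 0) (m 1) (m 2) (m 3) (m 4)); cadj C.
Qed.

(* A shared dominator would be a midpoint in D, hence it would dominate the
   adjacent midpoint [m k] as well. *)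
Lemma chain6_private v m i k x : chain 6 v m -> i < 6 -> k < 5 -> x < 6 ->
  e (v i) (m k) -> dom (v i) != dom (m k) -> x != i -> dom (v i) != dom (v x).
Proof.
move=> C ip kp xp; rewrite (chain_vm C) // => ik nd nxi; apply/eqP => E.
have near a b : a.+1 < b < 6 -> dom (v a) != dom (v b) by case: C => vF _ ?; apply/dom_far/vF.
have midE a : a < 5 -> dom (v a) = dom (v a.+1) -> m a = dom (v a).
  by case: C => _ vm a5; case: (vm a a5).
have cons a : a < 4 -> e (m a) (m a.+1) := chain6_consecutive C.
have share a : a < 5 -> k = a \/ k.+1 = a \/ k = a.+1 -> m a = dom (v i) -> False.
  move=> a5 ka ma; have aD : m a \in D by rewrite ma; case: (domP (v i)).
  case/eqP: nd; rewrite -ma; case: ka => [->|[ak|ka]]; first by rewrite dom_id.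
    by rewrite (@dom_adj (m a) (m k)) // -ak cons //; lia.
  by rewrite (@dom_adj (m a) (m k)) // ka sym_e cons //; lia.
case: (ltngtP x i) => [xi|xi|xi]; last by rewrite xi eqxx in nxi.
  have [xi1|xi1] := ltnP x.+1 i; first by have := near x i; rewrite E eqxx => /(_ _); lia.
  have Ei : i = x.+1 by lia.
  by apply: (share x); [lia | lia | rewrite midE -?Ei ?E //; lia].
have [xi1|xi1] := ltnP i.+1 x; first by have := near i x; rewrite E eqxx => /(_ _); lia.
have Ex : x = i.+1 by lia.
by apply: (share i); [lia | lia | rewrite midE -?Ex //; lia].
Qed.


(* [i = 1] needs [v 0] first: the vertex [v 1] is adjacent to [m 1], so if
   [m 1] is the detour from [m 0] to [m j], the P6 starts at [dom (v 0)]. *)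
Lemma chain6_remote v m i j a : chain 6 v m -> i < 2 ->
  (i = 1 -> dom (v 0) = dom (m 0)) -> dom (v i) != dom (m 0) ->
  2 < j < 5 -> (a == j) || (a == j.+1) -> dom (v a) = dom (m j).
Proof.
move=> C i2 v0m0 nd jb aj.
have vim0 : e (v i) (m 0) by rewrite (chain_vm C) //; arith.
have ap : a < 6 by arith.
have vamj : e (v a) (m j) by rewrite (chain_vm C) //; arith.
have fia : far (v i) (v a) by case: C => vF _; apply: vF; arith.
have private x : x < 6 -> x != i -> ~~ e (dom (v i)) (v x).
  by move=> xp nxi; apply/dom_diff_nadj/(chain6_private C _ _ xp vim0 nd nxi); arith.
have [vid ndm0] := dom_diff vim0 nd; have dm0 := dom_diff_nadj nd.
have indep := dom_indep (v i) (v a).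
have [m0j|n0j] := boolP (e (m 0) (m j)).
  exact: (dom_path fia vim0 m0j vamj vid ndm0 dm0 indep).
have [l [lj m0l mlj]] := chain6_reach C jb n0j.
have [il|il] := boolP ((i == 0) || (1 < l)).
  exfalso; apply: (@detour (v i) (v j.+1) (m 0) (m l) (m j) (v (1 - i)) (v l.+1)) => //.
  + by case: C => vF _; apply: vF; arith.
  + by rewrite (chain_vm C) //; arith.
  + by rewrite (chain_vm C) //; arith.
  + by rewrite (chain_vm C) //; arith.
  + by rewrite (chain_vm C) //; arith.
  + by rewrite sym_e (chain_vm C) //; arith.
  + by rewrite sym_e (chain_vm C) //; arith.
  + by apply: (chain_vv C); arith.
  + by apply: (chain_vv C); arith.
  + by rewrite (chain_vm C) //; arith.
  + by apply: (chain_vv C); arith.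
  + by apply: private; arith.
  + by apply: private; arith.
have Ei : i = 1 by arith.
have {lj il} El : l = 1 by arith.
subst i l; have {}v0m0 := v0m0 erefl.
have [d1|d1] := eqVneq (dom (v 1)) (dom (m 1)); last first.
  have v1m1 : e (v 1) (m 1) by rewrite (chain_vm C).
  have [vid1 ndm1] := dom_diff v1m1 d1; have dm1 := dom_diff_nadj d1.
  exact: (dom_path fia v1m1 mlj vamj vid1 ndm1 dm1 indep).
have [m0d _] : e (m 0) (dom (m 0)) /\ dom (m 0) != v 1.
  by apply: dom_diff; [rewrite sym_e | rewrite eq_sym].
have [m1d _] : e (m 1) (dom (m 1)) /\ dom (m 1) != m 0.
  by apply: dom_diff; [rewrite sym_e | rewrite -d1].
apply/eqP; apply: contraT => nda; have [vad nadj] := dom_diff vamj nda.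
have f0a : far (v 0) (v a) by case: C => vF _; apply: vF; arith.
have nd0a : dom (m 0) != dom (v a) by rewrite -v0m0; apply: dom_far.
have nd1a : dom (m 1) != dom (v a) by rewrite -d1; apply: dom_far.
have d0m1 : ~~ e (dom (m 0)) (m 1) by rewrite sym_e dom_nadj // -d1.
have nd01 : dom (m 0) != dom (m 1) by rewrite -d1 eq_sym.
have d0mj : ~~ e (dom (m 0)) (m j).
  apply/negP => d0mj; have dmj : dom (m j) = dom (m 0).
    by apply: dom_adj; [case: (domP (m 0)) | rewrite sym_e].
  apply: (@no_banner (m 1) (m 0) (dom (m 0)) (m j) (dom (m 1))) => //.
  + by rewrite sym_e.
  + by rewrite sym_e.
  + by apply: (@adj_neq _ _ (v 0)); [rewrite sym_e (chain_vm C) | rewrite sym_e (chain_vm C) //; arith].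
  + by rewrite dom_nadj.
  + by rewrite dom_indep.
  + by rewrite dom_nadj // dmj.
exfalso; apply: (@no_P6 (dom (m 0)) (m 0) (m 1) (m j) (v a) (dom (v a))) => //.
- by rewrite sym_e.
- by rewrite sym_e.
- by rewrite sym_e dom_nadj // eq_sym.
- by rewrite dom_indep.
- by rewrite sym_e (chain_vm C) //; arith.
- by rewrite dom_nadj.
- by rewrite sym_e (chain_vm C) //; arith.
- by rewrite dom_nadj.
- by rewrite dom_nadj // eq_sym.
Qed.

Lemma chain6_ends v m : chain 6 v m ->
  dom (v 0) = dom (m 0) /\ dom (v 1) = dom (m 0).
Proof.
move=> C.
have n35 : dom (v 3) != dom (v 5) by apply: dom_far; case: C => vF _; apply: vF.
suff clash i : i < 2 -> (i = 1 -> dom (v 0) = dom (m 0)) -> dom (v i) = dom (m 0).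
  by have v0 : dom (v 0) = dom (m 0) by [apply: clash]; split; last apply: clash.
move=> i2 v0m0; apply/eqP; apply: contraT => nd; case/eqP: n35.
have remote j a := @chain6_remote v m i j a C i2 v0m0 nd.
by rewrite (remote 3 3) // -(remote 3 4) // (remote 4 4) // (remote 4 5).
Qed.

Lemma no_chain6 v m : chain 6 v m -> False.
Proof.
move=> C; have [v0m0 v1m0] := chain6_ends C.
have [/= v5m4 v4m4] := chain6_ends (chain_rev C).
have m01 := @chain6_consecutive _ _ 0 C isT; have m12 := @chain6_consecutive _ _ 1 C isT.
have m23 := @chain6_consecutive _ _ 2 C isT; have m34 := @chain6_consecutive _ _ 3 C isT.
have ndv i j : i.+1 < j < 6 -> dom (v i) != dom (v j).
  by move=> ij; apply: dom_far; case: C => vF _; apply: vF.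
have midE i : i < 5 -> dom (v i) = dom (v i.+1) -> m i = dom (v i).
  by move=> ip; case: C => _ vm; case: (vm i ip).
rewrite /= in v5m4 v4m4.
have Em0 : m 0 = dom (v 0) by apply: midE; rewrite // v0m0 v1m0.
have Em4 : m 4 = dom (v 4) by apply: midE; rewrite // v5m4 v4m4.
have m0D : m 0 \in D by rewrite Em0; case: (domP (v 0)).
have m4D : m 4 \in D by rewrite Em4; case: (domP (v 4)).
have dm1 : dom (m 1) = m 0 by apply: dom_adj; rewrite // sym_e.
have dm3 : dom (m 3) = m 4 by apply: dom_adj.
have n04 : m 0 != m 4 by rewrite Em0 Em4; apply: ndv.
have n03 : ~~ e (m 0) (m 3) by apply: contra n04 => m03; rewrite -dm3 (@dom_adj (m 0)) // sym_e.
have n14 : ~~ e (m 1) (m 4) by apply: contra n04 => m14; rewrite -dm1 (@dom_adj (m 4) (m 1)).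
have n04e : ~~ e (m 0) (m 4) by rewrite Em0 Em4 dom_indep.
have [m02|n02] := boolP (e (m 0) (m 2)).
  have n24 : ~~ e (m 2) (m 4).
    by apply: contra n04 => m24; rewrite -(@dom_adj (m 0) (m 2)) 1?sym_e // (@dom_adj (m 4) (m 2)).
  by apply: (@no_P6 (v 0) (m 0) (m 2) (m 3) (m 4) (v 5)); cadj C.
have [m24|n24] := boolP (e (m 2) (m 4)).
  by apply: (@no_P6 (v 0) (m 0) (m 1) (m 2) (m 4) (v 5)); cadj C.
have bad3 : dom (v 3) != dom (m 3).
  by rewrite dm3 Em4 v4m4 -v5m4; apply: ndv.
have bad2 : dom (v 2) != dom (m 1).
  by rewrite dm1 Em0 eq_sym; apply: ndv.
have v3m3 : e (v 3) (m 3) by rewrite (chain_vm C).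
have v2m1 : e (v 2) (m 1) by rewrite (chain_vm C).
have [v3d _] := dom_diff v3m3 bad3; have [v2d _] := dom_diff v2m1 bad2.
have n32 : dom (v 3) != dom (v 2) by apply: (chain6_private C _ _ _ v3m3 bad3).
have [d3m2|d3m2] := eqVneq (dom (v 3)) (dom (m 2)); last first.
  apply: (@no_P6 (v 0) (m 0) (m 1) (m 2) (v 3) (dom (v 3))); try cadj C.
  - by rewrite dom_nadj // ndv.
  - by rewrite Em0 dom_indep.
  - by rewrite dom_nadj // dm1 Em0 ndv.
  - by rewrite dom_nadj // eq_sym.
apply: (@no_P6 (dom (v 2)) (v 2) (m 2) (m 3) (m 4) (v 5)); try cadj C.
- by rewrite dom_diff_nadj // -d3m2 eq_sym.
- by rewrite dom_diff_nadj // dm3 Em4 ndv.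
- by rewrite Em4 dom_indep.
- by rewrite dom_diff_nadj // ndv.
Qed.

Lemma no_end_edge v : square_path 6 v -> ~~ e (v 0) (v 1).
Proof.
move=> P; apply/negP => e01.
have [vF _] := P.
have f02 : far (v 0) (v 2) by apply: vF.
have f03 : far (v 0) (v 3) by apply: vF.
have f04 : far (v 0) (v 4) by apply: vF.
have f05 : far (v 0) (v 5) by apply: vF.
have f13 : far (v 1) (v 3) by apply: vF.
have f14 : far (v 1) (v 4) by apply: vF.
have f15 : far (v 1) (v 5) by apply: vF.
have f24 : far (v 2) (v 4) by apply: vF.
have f25 : far (v 2) (v 5) by apply: vF.
have f35 : far (v 3) (v 5) by apply: vF.
have n12 : ~~ e (v 1) (v 2) by adj.
have n23 : ~~ e (v 2) (v 3) := no_inner_edge (@square_path_sub _ 1 4 _ P isT).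
have n34 : ~~ e (v 3) (v 4) := no_inner_edge (@square_path_sub _ 2 4 _ P isT).
pose w i := v i.+1; pose m i := mid (w i) (w i.+1).
have C4 : chain 4 w m.
  by apply: (chain_mid (@square_path_sub _ 1 4 _ P isT)) => -[|[|[|]]].
have [w0m0 w1m0 _ _] := C4.2 0 isT; have [w1m1 w2m1 _ _] := C4.2 1 isT.
have [w2m2 w3m2 _ _] := C4.2 2 isT; rewrite /w in w0m0 w1m0 w1m1 w2m1 w2m2 w3m2.
have m01 : e (m 0) (m 1).
  by apply: contraT => n01; exfalso; apply: (@no_P6 (v 0) (v 1) (m 0) (v 2) (m 1) (v 3)); adj.
have m12 : e (m 1) (m 2).
  apply: contraT => n; rewrite sym_e in n.
  by have [_] := chain4 (chain_rev C4) n; rewrite /= sym_e m01.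
have m02 : e (m 0) (m 2).
  by apply: contraT => n02; exfalso; apply: (@no_P6 (v 0) (v 1) (m 0) (m 1) (m 2) (v 4)); adj.
have n45 : ~~ e (v 4) (v 5).
  by apply/negP => e45; apply: (@no_P6 (v 0) (v 1) (m 0) (m 2) (v 4) (v 5)); adj.
have C5 : chain 5 w m.
  by apply: (chain_mid (@square_path_sub _ 1 5 _ P isT)) => -[|[|[|[|]]]].
have [w3m3 w4m3 _ _] := C5.2 3 isT; rewrite /w in w3m3 w4m3.
have m23 : e (m 2) (m 3) by apply: (chain5 C5).
have m03 : e (m 0) (m 3).
  by apply: contraT => n03; exfalso; apply: (@no_P6 (v 0) (v 1) (m 0) (m 2) (m 3) (v 5)); adj.
have domE a j : far (v 1) (v a) -> far (v 0) (v a) -> e (v a) (m j) -> e (m 0) (m j) -> dom (v a) = dom (m j).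
  move=> f1a f0a vamj m0j; apply: (dom_path (y := v 0) f1a w0m0 m0j vamj).
  - by rewrite sym_e.
  - by rewrite eq_sym; apply: (@adj_neq _ _ (v 2)); adj.
  - by adj.
  - by rewrite dom_nadj // dom_far.
by case/eqP: (dom_far f35); rewrite (domE 3 2) // -(domE 4 2) // (domE 4 3) // (domE 5 3).
Qed.

Lemma no_square_path6 v : ~ square_path 6 v.
Proof.
move=> P; apply: (@no_chain6 v (fun i => mid (v i) (v i.+1))); apply: chain_mid => // i.
case: i => [|[|[|[|[|//]]]]] _; first exact: no_end_edge.
- exact: (no_inner_edge (@square_path_sub _ 0 4 _ P isT)).
- exact: (no_inner_edge (@square_path_sub _ 1 4 _ P isT)).
- exact: (no_inner_edge (@square_path_sub _ 2 4 _ P isT)).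
- by rewrite sym_e; exact: (no_end_edge (square_path_rev P)).
Qed.

End Graph.

Theorem theorem1 (T : finType) (e : rel T) :
  simple_graph e ->
  H_free (path_rel 6) e ->
  H_free banner_rel e ->
  (exists D : {set T}, efficient_dominating e D) ->
  H_free (path_rel 6) (square_rel e).
Proof.
move=> [sym_e irr_e] noP6 noB [D effD] [f [f_inj fE]].
apply: (no_square_path6 sym_e irr_e noP6 noB effD (v := fun i => f (inord i))).
split=> [i j ij|i ip]; last by rewrite fE /path_rel !inordK ?eqxx //; lia.
rewrite /far fE /path_rel (inj_eq f_inj) -val_eqE /= !inordK; lia.
Qed.
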